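(* Let $d\in\mathbb{N}$ and for $N\in\mathbb{N}$ let $H_A(dN)=\frac{(dN-2)^2}{4}+\mathcal V_d(N)\bigl(\mathcal V_d(N)+dN-2\bigr)$. Then, for fixed $d$, as $N\to\infty$, $$H_A(dN)=\frac{d^2}{(d+1)^2}\,\sqrt[d]{(d!)^2}\;N^{2+\frac{2}{d}}+O(N^2),$$ and moreover $$H_A(dN)\ \ge\ \left(\frac{d}{d+1}\sqrt[d]{d!}\;N^{1+\frac1d}-1\right)^2$$ for all $N\ge 2$.
   Context: Enumerate all monomials $t^\alpha=t_1^{\alpha_1}\cdots t_d^{\alpha_d}$ in $d$ variables (coefficient 1) as $\varphi^{(d)}_1,\varphi^{(d)}_2,\dots$ by nondecreasing total degree, and lexicographically within each degree, so $\varphi^{(d)}_1=1$, $\varphi^{(d)}_2=t_1,\dots,\varphi^{(d)}_{d+1}=t_d$, $\varphi^{(d)}_{d+2}=t_1^2$, and so on. For $x_1,\dots,x_N\in\mathbb{R}^d$ let $\psi^{(d)}_N(x_1,\dots,x_N)=\det\bigl(\varphi^{(d)}_i(x_j)\bigr)_{i,j=1}^N$, a polynomial on $\mathbb{R}^{dN}$. $\mathcal V_d(N)$ denotes the (total) degree of $\psi^{(d)}_N$, which equals $\sum_{i=1}^N\deg\varphi^{(d)}_i$. *)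

(* Defs.v *)
From HB Require Import structures.
From mathcomp Require Import all_boot all_order all_algebra.
From mathcomp Require mpoly.

Set Implicit Arguments.
Unset Strict Implicit.
Unset Printing Implicit Defensive.

(* The import of mpoly is confined to a module because its notations are
   incompatible with those of MathComp-Analysis. *)
Module Fekete.
Import mpoly.
Import GRing.Theory.
Local Open Scope ring_scope.

(* Degree first; within one degree, a monomial with larger exponents on the
   first variables comes earlier (t_1^2, t_1 t_2, ..., t_d^2), hence the
   exchange of a and b in the lexicographic comparison of exponents. *)
Definition mon_le d (a b : 'X_{1..d}) : bool :=
  (mdeg a < mdeg b)%N ||
  ((mdeg a == mdeg b) && (val b <= val a :> seqlexi nat)%O).

(* The enumeration of the monomials in d variables, indexed from 0. For d > 0
   there are at least i.+1 monomials of degree at most i, so the i-th monomial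
   is found among these; for d = 0 the default is used as soon as i > 0. *)
Definition mon d (i : nat) : 'X_{1..d} :=
  nth 0%MM
    (sort (@mon_le d) [seq bmnm m | m <- enum {: 'X_{1..d < i.+1}}]) i.

(* The coordinates of x_j, as variables of the polynomial ring of R^(N d). *)
Definition point (R : comNzRingType) d N (j : 'I_N) :
    d.-tuple {mpoly R[N * d]} :=
  [tuple 'X_(mxvec_index j k) | k < d].

Definition psi (R : comNzRingType) d N : {mpoly R[N * d]} :=
  \det (\matrix_(i < N, j < N) ('X_[R, mon d i] \mPo point R d j)).

(* msize is 1 + the total degree, for nonzero polynomials. *)
Definition deg_psi (R : comNzRingType) d N : nat := (msize (psi R d N)).-1.

End Fekete.

From mathcomp Require Import all_classical all_reals all_analysis.
Import numFieldNormedType.Exports.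
Local Open Scope ring_scope.

Definition H_A (R : realType) (d N : nat) : R :=
  let n : R := (d * N)%:R in
  let v : R := (Fekete.deg_psi R d N)%:R in
  (n - 2) ^+ 2 / 4 + v * (v + n - 2).

(* Main.v *)
Require Import Defs.
From mathcomp Require Import all_boot all_order all_algebra all_fingroup.
From mathcomp Require mpoly.
From mathcomp Require Import ring lra.

(** Write V for the degree of psi and n = d N. Completing the square gives
H_A = (V + n/2 - 1)^2, so everything reduces to comparing f(N) = V + d N / 2
with the leading term A(N) = d/(d+1) (d!)^(1/d) N^(1+1/d).

The degree is combinatorial. The determinant psi is the alternating sum, over
the permutations, of monomials that are pairwise distinct, because the phi_i
are, and whose common degree is the sum of the degrees of the phi_i; hence
nothing cancels and V is that sum ([deg_psiE]). There are C(d+k, d) monomials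
of degree at most k, so between the knots C(d+k, d) and C(d+k+1, d) the
function f is affine in N, with slope x = k + 1 + d/2 ([deg_psi_affine],
[degree_sum_affine]).

The comparison rests on Legendre duality. Put s = (d! N)^(1/d), so that
A = d/(d+1) N s. Young's inequality ([young_expr]) reads
A >= N y - y^(d+1) / ((d+1) d!) for all y >= 0, with equality at y = s.

For f >= A ([degree_ge]), replace A by its supporting line of slope s: what
remains is affine in N between two knots, and at a knot, where
f = d/(d+1) N (k + (d+1)/2), the claim follows from Young's inequality and
from d! C(d+k, d) = (k+1)...(k+d) <= (k + (d+1)/2)^d.

For the reverse ([degree_le]), take y = x, the slope of f itself: the terms in
N cancel and f - A <= (x^(d+1) - (k+1)...(k+d+1)) / ((d+1) d!). Since x is the
mean of the factors k+1, ..., k+d+1, the terms of order x^d cancel, and the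
right-hand side is O(x^(d-1)) ([ffact_ge]).

Finally H_A - A^2 = (f - 1 - A)(f - 1 + A) is O(x^(d-1)) O(N x) = O(N x^d),
which is O(N^2) because x^d = O(N) ([slope_expr_le]). *)

(** * Degree of the determinant *)

Module FeketeTheory.
Set Implicit Arguments.
Unset Strict Implicit.
Unset Printing Implicit Defensive.
Import mpoly.
Import GRing.Theory.
Import Fekete.

(** The elements satisfying a downward closed predicate are initial in a sorted
sequence. *)
Lemma sorted_filter_take (T : eqType) (e : rel T) (a : pred T) (s : seq T) :
  transitive e -> (forall x y, e x y -> a y -> a x) -> sorted e s ->
  filter a s = take (count a s) s.
Proof.
move=> e_tr a_dn; elim: s => //= x s IHs e_xs.
have /IHs {}IHs := path_sorted e_xs.
case: (boolP (a x)) => [_|a'x]; first by rewrite /= IHs.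
have c0 : count a s = 0.
  apply/eqP; rewrite -leqn0 leqNgt -has_count; apply/hasPn => y s_y.
  have e_xy : e x y by have /(order_path_min e_tr)/allP/(_ y s_y) := e_xs.
  by apply: contra a'x; apply: a_dn e_xy.
by rewrite c0 addn0 take0; apply/eqP; rewrite -size_eq0 size_filter c0.
Qed.

Lemma mxvec_index_inj m n (i i' : 'I_m) (j j' : 'I_n) :
  mxvec_index i j = mxvec_index i' j' -> (i, j) = (i', j').
Proof.
have [g gK _] := curry_mxvec_bij m n; move=> eq_ij.
by rewrite -[LHS]gK ?inE // -[RHS]gK ?inE //= eq_ij.
Qed.

Section Monomials.
Variable d : nat.
Implicit Types a m : 'X_{1..d}.

Lemma mon_le_total : total (@mon_le d).
Proof.
move=> a b; rewrite /mon_le [mdeg b == _]eq_sym.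
case: ltngtP => //= _; exact: Order.TotalTheory.le_total.
Qed.

Lemma mon_le_trans : transitive (@mon_le d).
Proof.
move=> b a c /orP[ab|/andP[/eqP ab ba]] /orP[bc|/andP[/eqP bc cb]]; rewrite /mon_le.
- by rewrite (ltn_trans ab bc).
- by rewrite -bc ab.
- by rewrite ab bc.
by rewrite ab bc eqxx (Order.POrderTheory.le_trans cb ba) orbT.
Qed.

Lemma mon_le_anti : antisymmetric (@mon_le d).
Proof.
move=> a b; rewrite /mon_le [mdeg b == _]eq_sym.
case: ltngtP => //= _ /Order.POrderTheory.le_anti ab.
by apply/val_inj/val_inj.
Qed.

(** The list from which [mon d i] reads its i-th item when n = i + 1. *)
Definition mons n : seq 'X_{1..d} :=
  sort (@mon_le d) [seq bmnm b | b <- enum {: 'X_{1..d < n}}].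

Lemma mem_mons n m : (m \in mons n) = (mdeg m < n).
Proof.
rewrite mem_sort; apply/mapP/idP => [[b _ ->]|lt_mn]; first exact: bmdeg.
by exists (BMultinom lt_mn); rewrite ?mem_enum.
Qed.

Lemma mons_uniq n : uniq (mons n).
Proof. by rewrite sort_uniq map_inj_uniq ?enum_uniq //; apply: val_inj. Qed.

(** Exponent vectors of degree at most n are the d-tuples over [0, n] of sum at
most n. *)
Lemma size_mons n : size (mons n.+1) = 'C(d + n, d).
Proof.
rewrite -card_partial_ord_partitions cardE.
pose F (t : d.-tuple 'I_n.+1) : 'X_{1..d} := Multinom (map_tuple val t).
rewrite -(size_map F); apply/perm_size/uniq_perm; first exact: mons_uniq.
  rewrite map_inj_uniq ?enum_uniq // => t u /(congr1 (fun m => val (val m))) /=.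
  by move/(inj_map val_inj)/val_inj.
have mdegF t : mdeg (F t) = \sum_(i <- t) i.
  by rewrite /mdeg /= big_map.
move=> m; rewrite mem_mons; apply/idP/mapP => [lt_mn|[t]].
  exists (map_tuple inord (val m)); last first.
    apply/val_inj/val_inj => /=; rewrite -map_comp -[LHS]map_id.
    apply/eq_in_map => k m_k /=; rewrite inordK //; apply: leq_ltn_trans lt_mn.
    by rewrite /mdeg (big_rem k) //= leq_addr.
  rewrite mem_enum inE -ltnS; apply: leq_ltn_trans lt_mn.
  rewrite /mdeg big_map big_seq [X in _ <= X]big_seq; apply: leq_sum => k m_k.
  by rewrite /inord /insubd; case: insubP => //= u _ ->.
by rewrite mem_enum inE => le_tn ->; rewrite mdegF.
Qed.

(** The degree is the first sorting criterion, so these lists extend one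
another; reading all the [mon d i] from one long list is what makes their
degrees and their distinctness accessible. *)
Lemma mons_take k n : k <= n -> mons k = take (size (mons k)) (mons n).
Proof.
move=> le_kn.
have -> : mons k = [seq a <- mons n | mdeg a < k].
  apply: (sorted_eq mon_le_trans mon_le_anti).
  - exact: sort_sorted mon_le_total _.
  - exact/(sorted_filter mon_le_trans)/sort_sorted/mon_le_total.
  apply: uniq_perm; rewrite ?filter_uniq ?mons_uniq // => a.
  rewrite mem_filter !mem_mons; case: ltnP => //= lt_am.
  by rewrite (leq_trans lt_am).
rewrite size_filter; apply: (sorted_filter_take mon_le_trans).
  move=> a b /orP[ab|/andP[/eqP-> _]] // bm; exact: ltn_trans bm.
exact: sort_sorted mon_le_total _.
Qed.

Hypothesis d_gt0 : 0 < d.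

Lemma bin_succ k : 'C(d + k.+1, d) = 'C(d + k, d) + 'C(d + k, d.-1).
Proof. by rewrite addnS -(prednK d_gt0) binS prednK. Qed.

(** The list of monomials of degree at most i is long enough to have an item of
index i. *)
Lemma ltn_bin i : i < 'C(d + i, d).
Proof.
elim: i => [|i IHi]; first by rewrite addn0 binn.
rewrite bin_succ -[i.+2]addn1 leq_add // bin_gt0.
exact: leq_trans (leq_pred d) (leq_addr i d).
Qed.

Lemma mon_nth i n : i < n -> mon d i = nth 0%MM (mons n) i.
Proof.
move=> lt_in; rewrite /mon -/(mons i.+1) (mons_take lt_in) nth_take //.
by rewrite size_mons ltn_bin.
Qed.

Lemma ltn_size_mons i n : i < n -> i < size (mons n).
Proof.
by case: n => // n; rewrite size_mons => /leq_trans; apply; apply: ltn_bin.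
Qed.

Lemma mon_inj : injective (mon d).
Proof.
move=> i j; pose n := maxn i.+1 j.+1.
have [ni nj] : i < n /\ j < n by rewrite !leq_max !leqnn orbT.
rewrite (mon_nth ni) (mon_nth nj) => /eqP; rewrite nth_uniq ?mons_uniq //; last first.
- exact: ltn_size_mons.
- exact: ltn_size_mons.
by move/eqP.
Qed.

(** The C(d+k, d) monomials of degree at most k form an initial segment of every
longer list. *)
Lemma mdeg_mon_lt i k : (mdeg (mon d i) < k.+1) = (i < 'C(d + k, d)).
Proof.
pose n := maxn i.+1 k.+1.
have [ni nk] : i < n /\ k < n by rewrite !leq_max !leqnn orbT.
have i_n := ltn_size_mons ni.
rewrite (mon_nth ni) -mem_mons (mons_take nk) in_take; last exact: mem_nth.
by rewrite index_uniq ?mons_uniq // size_mons.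
Qed.

Lemma mdeg_mon_eq i k :
  'C(d + k, d) <= i < 'C(d + k.+1, d) -> mdeg (mon d i) = k.+1.
Proof.
by rewrite -mdeg_mon_lt leqNgt -mdeg_mon_lt -leqNgt ltnS -eqn_leq => /eqP->.
Qed.

Definition sum_mdeg N := \sum_(0 <= i < N) mdeg (mon d i).

Lemma sum_mdeg_affine N k : 'C(d + k, d) <= N <= 'C(d + k.+1, d) ->
  sum_mdeg N = sum_mdeg 'C(d + k, d) + k.+1 * (N - 'C(d + k, d)).
Proof.
case/andP=> kN Nk; rewrite /sum_mdeg (big_cat_nat (leq0n _) kN) /=; congr (_ + _).
rewrite mulnC -sum_nat_const_nat; apply: eq_big_nat => i /andP[ki iN].
by apply: mdeg_mon_eq; rewrite ki (leq_trans iN).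
Qed.

(** Induction on k: the new layer contributes (k+1) C(d+k, d-1) = d C(d+k, d),
and Pascal's rule concludes. *)
Lemma sum_mdeg_full k : sum_mdeg 'C(d + k, d) = d * 'C(d + k, d.+1).
Proof.
elim: k => [|k IHk].
  rewrite addn0 binn bin_small // muln0 /sum_mdeg big_nat1.
  by apply/eqP; rewrite -leqn0 -ltnS mdeg_mon_lt addn0 binn.
have le_k : 'C(d + k, d) <= 'C(d + k.+1, d) by rewrite bin_succ leq_addr.
rewrite (@sum_mdeg_affine _ k) ?le_k ?leqnn // IHk bin_succ addKn addnS binS mulnDr.
congr (_ + _); have := mul_bin_left (d + k) d.-1.
rewrite prednK // => ->; congr (_ * _).
by rewrite -{1}(prednK d_gt0) addSnnS addKn.
Qed.

Local Open Scope ring_scope.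
Variable R : comNzRingType.

(** Each permutation s contributes plus or minus one monomial [M s], whose
exponents at the coordinates of the point s(j) are those of [mon d j].
Distinctness of the [mon d j] makes s recoverable from [M s], so no two terms
of the determinant cancel; all have the same degree. *)
Lemma deg_psiE N : deg_psi R d N = sum_mdeg N.
Proof.
pose M (s : 'S_N) : 'X_{1..N * d} :=
  (\sum_(i < N) \sum_(k < d) U_(mxvec_index (s i) k) *+ mon d i k)%MM.
have psiE : psi R d N = \sum_(s : 'S_N) (-1) ^+ s *: 'X_[R, M s].
  apply: eq_bigr => s _; rewrite mulr_sign -scaler_sign; congr (_ *: _).
  rewrite /M -mprodXE; apply: eq_bigr => i _; rewrite !mxE comp_mpolyX -mprodXnE.
  by apply: eq_bigr => k _; rewrite tnth_mktuple.
have M_val s j k : M s (mxvec_index (s j) k) = mon d j k.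
  have U_val i l : (U_(mxvec_index (s i) l) *+ mon d i l)%MM
      (mxvec_index (s j) k) = (((i == j) && (l == k)) * mon d i l)%N.
    rewrite mulmnE mnm1E; congr (nat_of_bool _ * _)%N.
    apply/eqP/andP => [/mxvec_index_inj[/perm_inj-> ->]|[/eqP-> /eqP->]] //.
  rewrite mnm_sumE (bigD1 j) //= mnm_sumE (bigD1 k) //= U_val !eqxx mul1n.
  rewrite big1 => [|l /negPf l'k]; last by rewrite U_val l'k andbF.
  rewrite big1 ?addn0 // => i /negPf i'j; rewrite mnm_sumE big1 // => l _.
  by rewrite U_val i'j.
have M_inj s t : M s = M t -> s = t.
  move=> eq_M; apply/permP => j; set i := (t^-1)%g (s j).
  suff ij : i = j by rewrite -[in RHS]ij permKV.
  apply/val_inj/mon_inj/mnmP => k.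
  by rewrite -[RHS](M_val s) eq_M -[s j](permKV t) M_val.
have mdeg_M s : mdeg (M s) = sum_mdeg N.
  rewrite mdeg_sum /sum_mdeg big_mkord; apply: eq_bigr => i _.
  rewrite mdeg_sum mdegE; apply: eq_bigr => k _.
  by rewrite mdegMn mdeg1 mul1n.
have homog_psi : psi R d N \is (sum_mdeg N).-homog for mdeg.
  by rewrite psiE rpred_sum // => s _; rewrite rpredZ // dhomogX; apply/eqP/mdeg_M.
have psi_neq0 : psi R d N != 0.
  apply/eqP => /(congr1 (mcoeff (M 1%g))); rewrite psiE mcoeff0 raddf_sum /=.
  rewrite (bigD1 1%g) //= big1 => [|s s_neq1]; last first.
    rewrite mcoeffZ mcoeffX; case: eqP => [/M_inj s1|_]; last by rewrite mulr0.
    by rewrite s1 eqxx in s_neq1.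
  by rewrite mcoeffZ mcoeffX eqxx odd_perm1 mulr1 addr0 => /eqP; rewrite oner_eq0.
exact: dhomog_uniq psi_neq0 (dhomog_msize homog_psi) homog_psi.
Qed.

Lemma deg_psi_affine N k : ('C(d + k, d) <= N <= 'C(d + k.+1, d))%N ->
  deg_psi R d N = (d * 'C(d + k, d.+1) + k.+1 * (N - 'C(d + k, d)))%N.
Proof. by move=> kN; rewrite deg_psiE (sum_mdeg_affine kN) sum_mdeg_full. Qed.

Lemma layer_exists N : (0 < N)%N ->
  exists k, ('C(d + k, d) <= N <= 'C(d + k.+1, d))%N.
Proof.
elim: N => // -[|N] IHN _; first by exists 0%N; rewrite addn0 binn bin_gt0 leq_addr.
have [//|k /andP[kN]] := IHN; rewrite leq_eqVlt => /orP[/eqP Nk|Nk].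
  exists k.+1; rewrite -Nk leqnSn bin_succ -Nk -[N.+2]addn1 leq_add2l bin_gt0.
  exact: leq_trans (leq_pred d) (leq_addr _ d).
by exists k; rewrite Nk (leq_trans kN).
Qed.

End Monomials.
End FeketeTheory.

(** * Inequalities between powers and falling factorials *)

Module RealEstimates.
Section RealEstimates.
Set Implicit Arguments.
Unset Strict Implicit.
Import Order.TTheory GRing.Theory Num.Theory.
Local Open Scope ring_scope.
Variable R : realFieldType.
Implicit Types (x y s t M N : R) (d k m n : nat).

(** Young's inequality with exponents (d+1)/d and d+1, cleared of denominators.
In the induction the defect at d+1 is x times the defect at d, plus
(d+1) s^d (s - x)^2. *)
Lemma young_expr d s x : 0 <= s -> 0 <= x ->
  d.+1%:R * s ^+ d * x <= d%:R * s ^+ d.+1 + x ^+ d.+1.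
Proof.
move=> s0 x0; elim: d => [|d IHd]; first by rewrite expr0 expr1; lra.
rewrite -subr_ge0.
have -> : d.+1%:R * s ^+ d.+2 + x ^+ d.+2 - d.+2%:R * s ^+ d.+1 * x
  = x * (d%:R * s ^+ d.+1 + x ^+ d.+1 - d.+1%:R * s ^+ d * x)
    + d.+1%:R * s ^+ d * (s - x) ^+ 2.
  by rewrite !exprS; ring.
by rewrite addr_ge0 // mulr_ge0 ?subr_ge0 ?sqr_ge0 // mulr_ge0 ?exprn_ge0.
Qed.

(** The Weierstrass product inequality, in homogeneous form. *)
Lemma prod_sub_ge m (u : R) (b : nat -> R) :
  (forall i, (i < m)%N -> 0 <= b i <= u) ->
  u ^+ m - (\sum_(i < m) b i) * u ^+ m.-1 <= \prod_(i < m) (u - b i).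
Proof.
elim: m => [|m IHm] b_u; first by rewrite !big_ord0 mul0r subr0.
have /andP[bm0 bmu] := b_u m (ltnSn m).
have u0 := le_trans bm0 bmu.
have /IHm {}IHm : forall i, (i < m)%N -> 0 <= b i <= u.
  by move=> i /ltnW; apply: b_u.
rewrite !big_ord_recr /=; apply: le_trans (ler_wpM2r _ IHm); last first.
  by rewrite subr_ge0.
have S0 : 0 <= \sum_(i < m) b i.
  by apply: sumr_ge0 => i _; have /andP[] := b_u i (ltnW (ltn_ord i)).
case: m => [|m] in b_u bm0 bmu IHm S0 *; first by rewrite !big_ord0 !expr0 expr1; lra.
move: (\sum_(i < _) _) S0 => S S0 /=; rewrite !exprS -subr_ge0.
rewrite [leRHS](_ : _ = S * b m.+1 * u ^+ m); last by ring.
by rewrite !mulr_ge0 ?exprn_ge0.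
Qed.

(** The sum of the squared distances to their mean of m consecutive integers. *)
Definition spread m : R := \sum_(i < m) ((m%:R - 1) / 2 - i%:R) ^+ 2.

Lemma spread_ge0 m : 0 <= spread m.
Proof. by apply: sumr_ge0 => i _; apply: sqr_ge0. Qed.

Lemma ffactE m n : (m <= n)%N ->
  (n ^_ m)%:R = \prod_(i < m) (n%:R - i%:R) :> R.
Proof.
move=> le_mn; rewrite ffact_prod natr_prod; apply: eq_bigr => i _.
by rewrite natrB // (leq_trans _ le_mn) // ltnW.
Qed.

(** Pairing each factor with its mirror image about the mean of the factors
turns the squared falling factorial into a product of differences of squares,
where both bounds below can be read off. *)
Lemma ffact_sqr m n : (m <= n)%N ->
  (n ^_ m)%:R ^+ 2
  = \prod_(i < m) ((n%:R - (m%:R - 1) / 2) ^+ 2 - ((m%:R - 1) / 2 - i%:R) ^+ 2) :> R.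
Proof.
move=> le_mn; rewrite expr2 {2}ffactE // (reindex_inj rev_ord_inj) ffactE //.
rewrite -big_split; apply: eq_bigr => i _ /=; rewrite natrB //.
by rewrite -natr1; field.
Qed.

Lemma dist_mean_le m n i : (i < m <= n)%N ->
  0 <= ((m%:R - 1) / 2 - i%:R : R) ^+ 2 <= (n%:R - (m%:R - 1) / 2) ^+ 2.
Proof.
case/andP; rewrite -!(ler_nat R) -natr1 => lt_im le_mn; rewrite sqr_ge0 /=.
have i0 : 0 <= i%:R :> R by [].
have : 0 <= (n%:R - i%:R) * (n%:R - (m%:R - 1) + i%:R) :> R.
  by apply: mulr_ge0; lra.
lra.
Qed.

Lemma ffact_le m n : (m <= n)%N ->
  (n ^_ m)%:R <= (n%:R - (m%:R - 1) / 2) ^+ m :> R.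
Proof.
move=> le_mn; have le_mnR : m%:R <= n%:R :> R by rewrite ler_nat.
have m0 : 0 <= m%:R :> R by [].
rewrite -ler_sqr ?nnegrE ?exprn_ge0 //; last by lra.
rewrite ffact_sqr // -exprM mulnC exprM -[X in _ <= _ ^+ X]card_ord -prodr_const.
apply: ler_prod => i _.
have /andP[d0 dle] := @dist_mean_le m n i (introT andP (conj (ltn_ord i) le_mn)).
by rewrite subr_ge0 dle gerBl.
Qed.

(** The falling factorial falls short of the power of the mean x of its factors
by a relative error of order 1/x^2 only: there is no error of order 1/x because the
deviations from the mean sum to 0. The multiplication by x^2 avoids the
exponent m - 2. *)
Lemma ffact_ge m n x : (m <= n)%N -> x = n%:R - (m%:R - 1) / 2 ->
  x ^+ m * (x ^+ 2 - spread m) <= x ^+ 2 * (n ^_ m)%:R.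
Proof.
move=> le_mn xE; have le_mnR : m%:R <= n%:R :> R by rewrite ler_nat.
have m0 : 0 <= m%:R :> R by [].
have x0 : 0 <= x by rewrite xE; lra.
have [le_u|lt_u] := leP (x ^+ 2) (spread m).
  apply: (@le_trans _ _ 0); last by rewrite mulr_ge0 ?exprn_ge0.
  by rewrite mulr_ge0_le0 ?exprn_ge0 // subr_le0.
have v0 : 0 <= x ^+ 2 - spread m by lra.
rewrite -ler_sqr ?nnegrE ?mulr_ge0 ?exprn_ge0 // !exprMn ffact_sqr // -xE.
have := @prod_sub_ge m (x ^+ 2) (fun i => ((m%:R - 1) / 2 - i%:R) ^+ 2).
have /[swap]/[apply] : forall i, (i < m)%N ->
    0 <= ((m%:R - 1) / 2 - i%:R : R) ^+ 2 <= x ^+ 2.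
  by move=> i lt_im; rewrite xE; apply: dist_mean_le; rewrite lt_im.
rewrite -/(spread m) => le_prod.
apply: le_trans (ler_wpM2l _ le_prod); last by rewrite -expr2 sqr_ge0.
case: m => [|m] in le_mn le_mnR m0 xE x0 lt_u v0 le_prod *.
  by move: v0; rewrite /spread big_ord0; lra.
rewrite /= -[x ^+ m.+1 ^+ 2]exprM mulnC exprM !(exprS (x ^+ 2)).
move: (x ^+ 2) (spread _) (spread_ge0 m.+1) v0 => u b b0 v0.
rewrite -subr_ge0 [leRHS](_ : _ = b * (u - b) * u * u ^+ m); last by ring.
by rewrite !mulr_ge0 ?exprn_ge0 //; lra.
Qed.

(** With D = d!, M the number of monomials of degree at most k and
y = k + (d+1)/2, this says that at the knot M the function f lies above the
supporting line of slope s of the leading term. *)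
Lemma young_at_knot d (D M s y : R) : 0 < D -> 0 <= M -> 0 <= s -> 0 <= y ->
  D * M <= y ^+ d -> d.+1%:R * (M * s) <= d%:R * (M * y) + s ^+ d.+1 / D.
Proof.
move=> D0 M0 s0 y0 le_DM.
have q0 : 0 <= s ^+ d.+1 / D by rewrite divr_ge0 ?exprn_ge0 // ltW.
have [le_sy|lt_ys] := leP (d.+1%:R * s) (d%:R * y).
  by have := ler_wpM2l M0 le_sy; lra.
rewrite -lerBlDl [leLHS](_ : _ = M * (d.+1%:R * s - d%:R * y)); last by ring.
rewrite ler_pdivlMr // mulrC mulrA.
have le_sy : 0 <= d.+1%:R * s - d%:R * y by lra.
apply: le_trans (ler_wpM2r le_sy le_DM) _.
by have := young_expr d y0 s0; rewrite [y ^+ d.+1]exprS; lra.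
Qed.

(** * The sum of degrees compared with its leading term *)

Variable d : nat.
Hypothesis d_gt0 : (0 < d)%N.

(** The slope, in N, of the sum of degrees plus d N / 2 while the degree of the
added monomials is k + 1; it is also the mean of k+1, ..., k+d+1. *)
Definition slope k : R := k%:R + 1 + d%:R / 2.

Lemma bin_factE k : 'C(d + k, d)%:R * d`!%:R = ((d + k) ^_ d)%:R :> R.
Proof. by rewrite -natrM bin_ffact. Qed.

(** The constant term is -(k+1)...(k+d+1) / ((d+1) d!), the product that
[degree_le] compares with the power of its mean factor. *)
Lemma degree_sum_affine k (N V : nat) :
    ('C(d + k, d) <= N)%N ->
    V = (d * 'C(d + k, d.+1) + k.+1 * (N - 'C(d + k, d)))%N ->
  V%:R + (d * N)%:R / 2
  = N%:R * slope k - (d + k.+1)%:R / d.+1%:R * 'C(d + k, d)%:R :> R.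
Proof.
move=> kN ->; have /(congr1 (fun n => n%:R : R)) := mul_bin_left (d + k) d.
rewrite addKn !natrM => binE; have d1 : d.+1%:R != 0 :> R by rewrite pnatr_eq0.
rewrite natrD !natrM natrB // /slope addnS -![_.+1%:R]natr1 natrD.
have -> : 'C(d + k, d.+1)%:R = k%:R * 'C(d + k, d)%:R / (d%:R + 1) :> R.
  by rewrite -binE natr1 mulrC mulKf.
by field; rewrite natr1.
Qed.

Lemma bin_next k :
  k.+1%:R * 'C(d + k.+1, d)%:R = (d + k.+1)%:R * 'C(d + k, d)%:R :> R.
Proof.
rewrite addnS -!natrM; congr _%:R; have := mul_bin_down (d + k).+1 d.
by rewrite -addnS addKn addnS.
Qed.

(** The mean of the factors k+1, ..., k+d of d! C(d+k, d) is the slope minus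
1/2. *)
Lemma bin_le_mean k : d`!%:R * 'C(d + k, d)%:R <= (slope k - 2^-1) ^+ d :> R.
Proof.
rewrite mulrC bin_factE; apply: le_trans (ffact_le (leq_addr k d)) _.
rewrite le_eqVlt; apply/orP/or_introl/eqP; congr (_ ^+ _).
by rewrite /slope natrD; field.
Qed.

Lemma slope_ge1 k : 1 <= slope k.
Proof.
have d0 : 0 <= d%:R :> R by []; have k0 : 0 <= k%:R :> R by [].
by rewrite /slope; lra.
Qed.

(** Here x <= (k+1)(d+1), while d! C(d+k, d) is a product of d factors that are
at least k+1. *)
Lemma slope_expr_le k (N : nat) : ('C(d + k, d) <= N)%N ->
  slope k ^+ d <= (d.+1 ^ d * d`!)%:R * N%:R.
Proof.
move=> kN.
apply: (@le_trans _ _ (((k.+1 * d.+1)%:R : R) ^+ d)).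
  rewrite lerXn2r ?nnegrE //; first by have := slope_ge1 k; lra.
  rewrite /slope natrM -(natr1 d) -(natr1 k).
  have k0 : 0 <= k%:R :> R by [].
  have d0 : 0 <= d%:R :> R by [].
  by have := mulr_ge0 k0 d0; lra.
rewrite -natrX -natrM ler_nat expnMn mulnC -mulnA leq_mul2l; apply/orP; right.
apply: (@leq_trans (d`! * 'C(d + k, d))%N); last by rewrite leq_mul2l kN orbT.
rewrite mulnC bin_ffact ffact_prod.
apply: (@leq_trans (\prod_(i < d) k.+1)%N); first by rewrite prod_nat_const card_ord.
by apply: leq_prod => i _; rewrite ltn_subRL ltn_add2r.
Qed.

(** Characterizing s by its d-th power, rather than as a power of d! N with a
fractional exponent, leaves only polynomial inequalities to prove. *)
Section Layer.
Variables (k N V : nat) (s : R).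
Hypothesis kN : ('C(d + k, d) <= N <= 'C(d + k.+1, d))%N.
Hypothesis V_E : V = (d * 'C(d + k, d.+1) + k.+1 * (N - 'C(d + k, d)))%N.
Hypothesis s_ge0 : 0 <= s.
Hypothesis s_root : s ^+ d = d`!%:R * N%:R.

Let f : R := V%:R + (d * N)%:R / 2.
Let A : R := d%:R / (d%:R + 1) * N%:R * s.

(** Since N s = s^(d+1) / d!, the leading term at N lies on its own supporting
line of slope s; f dominates that line at both knots, hence between them. *)
Lemma degree_ge : A <= f.
Proof.
case/andP: kN => kN1 kN2; rewrite /f (degree_sum_affine kN1 V_E).
have fact0 : 0 < d`!%:R :> R by rewrite ltr0n fact_gt0.
have d1 : 0 < d.+1%:R :> R by [].
have mid0 := slope_ge1 k.
have le_k := young_at_knot fact0 (ler0n _ _) s_ge0 _ (bin_le_mean k).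
have le_k1 := young_at_knot fact0 (ler0n _ _) s_ge0 _ (bin_le_mean k.+1).
have qE : s ^+ d.+1 / d`!%:R = N%:R * s.
  by rewrite exprS s_root; field; rewrite gt_eqF.
rewrite -(ler_pM2l d1) /A natr1.
rewrite [leLHS](_ : _ = d%:R * N%:R * s); last by field; rewrite nat1r pnatr_eq0.
rewrite [leRHS](_ : _ = d.+1%:R * N%:R * slope k
   - (d + k.+1)%:R * 'C(d + k, d)%:R); last by field; rewrite nat1r pnatr_eq0.
have y0 : 0 <= slope k - 2^-1 by lra.
have y1 : 0 <= slope k.+1 - 2^-1 by move: mid0; rewrite /slope -(natr1 k); lra.
move: (le_k y0) (le_k1 y1); rewrite qE -bin_next {le_k le_k1 y0 y1}.
have {}kN1 : 'C(d + k, d)%:R <= N%:R :> R by rewrite ler_nat.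
have {}kN2 : N%:R <= 'C(d + k.+1, d)%:R :> R by rewrite ler_nat.
have := bin_next k; rewrite /slope natrD -!(natr1 d) -!(natr1 k).
move: ('C(d + k, d)%:R) ('C(d + k.+1, d)%:R) kN1 kN2 => M M1 NM NM1 M1E le_k le_k1.
(* The difference to the line is monotone in N: the sign of its slope decides
   which knot gives the minimum. *)
have [le_sx|lt_xs] := leP s (k%:R + 1 + d%:R / 2).
  have : 0 <= (d%:R + 1) * ((N%:R - M) * (k%:R + 1 + d%:R / 2 - s)).
    by rewrite natr1 mulr_ge0 // mulr_ge0 // subr_ge0.
  lra.
have : 0 <= (d%:R + 1) * ((M1 - N%:R) * (s - (k%:R + 1 + d%:R / 2))).
  by rewrite natr1 mulr_ge0 // mulr_ge0 ?subr_ge0 // ltW.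
lra.
Qed.

(** Young's inequality at the slope of f: the terms in N cancel, leaving the
defect between x^(d+1) and (k+1)...(k+d+1), which [ffact_ge] bounds. *)
Lemma degree_le : f <= A + spread d.+1 * slope k ^+ d.-1.
Proof.
case/andP: kN => kN1 kN2; rewrite /f (degree_sum_affine kN1 V_E).
have x1 := slope_ge1 k; have x0 : 0 <= slope k by lra.
have fact1 : 1 <= d`!%:R :> R by rewrite ler1n fact_gt0.
have xE : slope k = (d + k.+1)%:R - (d.+1%:R - 1) / 2.
  by rewrite /slope natrD -(natr1 d) -(natr1 k); field.
have := ffact_ge _ xE; rewrite addnS ltnS leq_addr ffactSS natrM -bin_factE.
move=> /(_ isT) le_Q; have := young_expr d s_ge0 x0.
rewrite [s ^+ d.+1]exprS s_root => young.
have B0 := spread_ge0 d.+1; have X0 : 0 <= slope k ^+ d.-1 by rewrite exprn_ge0.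
have dE : slope k ^+ d.+1 = slope k ^+ 2 * slope k ^+ d.-1.
  by rewrite -exprD add2n prednK.
have {}le_Q : slope k ^+ d.+1 - spread d.+1 * slope k ^+ d.-1 <=
    (d + k.+1)%:R * ('C(d + k, d)%:R * d`!%:R).
  have x2 : 0 < slope k ^+ 2 by rewrite exprn_gt0 //; lra.
  by rewrite -(ler_pM2l x2) addnS; move: le_Q; rewrite dE; lra.
have c0 : 0 < d.+1%:R * d`!%:R :> R by rewrite mulr_gt0 //; lra.
rewrite -(ler_pM2l c0) /A natr1.
rewrite [leLHS](_ : _ = d.+1%:R * (d`!%:R * N%:R) * slope k
   - (d + k.+1)%:R * ('C(d + k, d)%:R * d`!%:R)); last by field; rewrite nat1r pnatr_eq0.
rewrite [leRHS](_ : _ = d%:R * (s * (d`!%:R * N%:R))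
   + d.+1%:R * d`!%:R * (spread d.+1 * slope k ^+ d.-1)); last first.
  by field; rewrite nat1r pnatr_eq0.
have : spread d.+1 * slope k ^+ d.-1 <=
    d.+1%:R * d`!%:R * (spread d.+1 * slope k ^+ d.-1).
  rewrite ler_peMl ?mulr_ge0 // -natrM ler1n muln_gt0 fact_gt0 //.
lra.
Qed.

End Layer.

End RealEstimates.
End RealEstimates.

From mathcomp Require Import all_classical all_reals all_analysis.
Import numFieldNormedType.Exports.
Local Open Scope classical_set_scope.
Local Open Scope ring_scope.

Import Order.TTheory GRing.Theory Num.Theory.
Import FeketeTheory RealEstimates.

(** * Estimates for H_A *)

Section Asymptotics.
Set Implicit Arguments.
Unset Strict Implicit.
Variables (R : realType) (d : nat).
Hypothesis d_gt0 : (0 < d)%N.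

Let leading (N : nat) : R :=
  d%:R / (d%:R + 1) * (d`!)%:R `^ (d%:R)^-1 * N%:R `^ (1 + (d%:R)^-1).

Lemma H_A_sqr N :
  H_A R d N = ((Fekete.deg_psi R d N)%:R + (d * N)%:R / 2 - 1) ^+ 2.
Proof. by rewrite /H_A; field. Qed.

Lemma leadingE N : (0 < N)%N ->
  leading N = d%:R / (d%:R + 1) * N%:R * (d`!%:R * N%:R) `^ (d%:R)^-1.
Proof.
move=> N0; rewrite powRM ?ler0n // /leading powRD; last first.
  by rewrite pnatr_eq0 -lt0n N0 implybT.
by rewrite powRr1 ?ler0n //; ring.
Qed.

Lemma leading_sqr N :
  leading N ^+ 2 = d%:R ^+ 2 / (d%:R + 1) ^+ 2
         * ((d`!)%:R ^+ 2) `^ (d%:R)^-1 * N%:R `^ (2 + 2 / d%:R).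
Proof.
have -> : 2 + 2 / d%:R = (1 + (d%:R)^-1) * 2%:R :> R by ring.
rewrite powRrM powR_mulrn ?powR_ge0 // -(@powR_mulrn R d`!%:R 2) ?ler0n //.
by rewrite powRAC powR_mulrn ?powR_ge0 // /leading !exprMn exprVn.
Qed.

Lemma root_expr N : ((d`!%:R * N%:R) `^ (d%:R)^-1) ^+ d = d`!%:R * N%:R :> R.
Proof.
rewrite -powR_mulrn ?powR_ge0 // -powRrM mulVf ?powRr1 ?mulr_ge0 ?ler0n //.
by rewrite pnatr_eq0 -lt0n.
Qed.

Lemma leading_ge0 N : 0 <= leading N.
Proof. by rewrite /leading !mulr_ge0 ?powR_ge0 // invr_ge0 addr_ge0 // ler0n. Qed.

Lemma leading_le N : (0 < N)%N ->
  leading N <= (Fekete.deg_psi R d N)%:R + (d * N)%:R / 2.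
Proof.
move=> N0; have [k kN] := layer_exists d_gt0 N0; rewrite leadingE //.
exact: degree_ge kN (deg_psi_affine d_gt0 R kN) (powR_ge0 _ _) (root_expr N).
Qed.

(** The three factors are at least 1/2, 1 and N. This keeps the quantity squared
in the lower bound for H_A nonnegative. *)
Lemma leading_ge1 N : (2 <= N)%N -> 1 <= leading N.
Proof.
move=> N2; rewrite -(ler_nat R) in N2.
have N1 : 1 <= N%:R :> R by lra.
have d1 : 1 <= d%:R :> R by rewrite ler1n.
have fact_ge1 : 1 <= d`!%:R `^ (d%:R)^-1 :> R.
  rewrite -[leLHS](@powRr0 R d`!%:R) ler_powR // ?ler1n ?fact_gt0 // invr_ge0; lra.
have pow_ge : N%:R <= N%:R `^ (1 + (d%:R)^-1) :> R.
  apply: le1r_powR => //; rewrite lerDl invr_ge0; lra.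
have half : 2^-1 <= d%:R / (d%:R + 1) :> R.
  by rewrite ler_pdivlMr; lra.
apply: (@le_trans _ _ (2^-1 * 1 * 2)); first by lra.
by rewrite /leading; apply: ler_pM; [lra|lra| |lra]; apply: ler_pM; lra.
Qed.

Definition error_const : R :=
  3 * (1 + spread R d.+1) * (d.+1 ^ d * d`!)%:R.

(** The product of |f - 1 - A| = O(x^(d-1)) and |f - 1 + A| = O(N x). *)
Lemma H_A_error N : (0 < N)%N ->
  `|H_A R d N - leading N ^+ 2| <= error_const * `|N%:R ^+ 2|.
Proof.
move=> N0; have [k kN] := layer_exists d_gt0 N0.
have V_E := deg_psi_affine d_gt0 R kN.
have le_up := degree_le d_gt0 kN V_E (powR_ge0 _ _) (root_expr N).
rewrite -leadingE // in le_up; have le_low := leading_le N0; have A0 := leading_ge0 N.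
have /andP[kN1 _] := kN; have f_E := degree_sum_affine R kN1 V_E.
have le_xd := slope_expr_le R kN1; have x1 := slope_ge1 R d k.
have B0 := spread_ge0 R d.+1.
have N1 : 1 <= N%:R :> R by rewrite ler1n.
rewrite H_A_sqr subr_sqr normrM.
set f := (Fekete.deg_psi R d N)%:R + (d * N)%:R / 2 in le_up le_low f_E *.
move: (leading N) A0 le_up le_low => A A0 le_up le_low.
set x := slope R d k in le_up f_E le_xd x1 *.
have xd1 : 1 <= x ^+ d.-1 by rewrite exprn_ege1.
have le_minus : `|f - 1 - A| <= (1 + spread R d.+1) * x ^+ d.-1.
  by rewrite ler_norml; nra.
have le_plus : `|f - 1 + A| <= 3 * (N%:R * x).
  have f_le : f <= N%:R * x.
    by rewrite f_E gerBl mulr_ge0 ?divr_ge0 ?ler0n.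
  have Nx1 : 1 <= N%:R * x by rewrite -[leLHS]mulr1 ler_pM //; lra.
  by rewrite ler_norml; lra.
apply: le_trans (ler_pM _ _ le_minus le_plus) _; rewrite ?normr_ge0 //.
rewrite [leLHS](_ : _ = 3 * (1 + spread R d.+1) * N%:R * x ^+ d); last first.
  have -> : x ^+ d = x * x ^+ d.-1 by rewrite -exprS prednK.
  by ring.
rewrite ger0_norm ?sqr_ge0 // /error_const.
rewrite [leRHS](_ : _ = 3 * (1 + spread R d.+1) * N%:R
   * ((d.+1 ^ d * d`!)%:R * N%:R)); last by ring.
by apply: ler_wpM2l => //; rewrite !mulr_ge0 //; lra.
Qed.

End Asymptotics.

Theorem mainTheorem5 (R : realType) (d : nat) (hd : (0 < d)%N) :
  (fun N : nat => H_A R d N : R^o)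
    = (fun N : nat =>
         d%:R ^+ 2 / (d%:R + 1) ^+ 2
         * ((d`!)%:R ^+ 2) `^ (d%:R)^-1
         * N%:R `^ (2 + 2 / d%:R) : R^o)
      +O_\oo (fun N : nat => N%:R ^+ 2 : R^o)
  /\
  (forall N : nat, (2 <= N)%N ->
     (d%:R / (d%:R + 1) * (d`!)%:R `^ (d%:R)^-1
      * N%:R `^ (1 + (d%:R)^-1) - 1) ^+ 2 <= H_A R d N).
Proof.
split.
  apply/eqaddOP; near=> K; near=> N.
  rewrite -[(_ - _) N]/(H_A R d N - _) /= -leading_sqr.
  apply: le_trans (H_A_error R hd _) _; first by near: N; exists 1%N.
  rewrite ler_wpM2r ?normr_ge0 //; near: K; exact: nbhs_pinfty_ge.
move=> N N2; rewrite H_A_sqr.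
have := leading_ge1 R hd N2; have := leading_le R hd (ltnW N2).
set A := (_ / _ * _ * _); set f := (_ + _) => le_Af le_1A.
by rewrite -subr_ge0 subr_sqr mulr_ge0 //; lra.
Unshelve. all: by end_near.
Qed.
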